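(* Let $G=(V,E)$ be a hypergraph with $m$ edges, rank $r$ and size $M$, let $w:V\to\mathbb{R}^+$ be vertex weights, and let $\epsilon>0$. On input $(G,w,\epsilon)$, the algorithm Cover (defined in the context), run on an EREW-PRAM, requires $O\!\left(r\,\ln^2 m\,\ln\frac{1}{\epsilon}\right)$ time and $M/\ln^2 m$ processors, i.e., $O\!\left(r\,M\,\ln\frac{1}{\epsilon}\right)$ operations.
   Context: Hypergraph: a vertex set $V$ and a set $E\subseteq 2^V$ of edges; $E(v)$ is the set of edges incident to (containing) the vertex $v$. The rank $r$ is the maximum size of any edge, and the size $M$ is the sum of the edge sizes. A vertex cover is a set $C\subseteq V$ such that every edge contains some vertex of $C$; its weight is $w(C)=\sum_{v\in C}w(v)$. The algorithm is meant to return a vertex cover of weight at most $r/(1-\epsilon)$ times the minimum. (Equivalently, in set-cover terms: vertices are sets, edges are elements, $m$ is the number of elements, $M$ is the sum of the set sizes, and $r$ is the maximum number of sets in which any element occurs.) Algorithm Cover$(G,w,\epsilon)$. 1. For each $v\in V$ in parallel: $w_p(v)\leftarrow w(v)$; $E_p(v)\leftarrow E(v)$; $d_p(v)\leftarrow |E(v)|$. 2. While edges remain, do one iteration: (a) for each remaining edge $e$ in parallel, $\delta(e)\leftarrow\min_{v\in e} w_p(v)/d_p(v)$; (b) for each remaining vertex $v$ in parallel, $w_p(v)\leftarrow w_p(v)-\sum_{e\in E_p(v)}\delta(e)$, and if then $w_p(v)\le\epsilon\,w(v)$, delete $v$ and its incident edges, updating the sets $E_p(\cdot)$ of remaining incident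 edges and the degrees $d_p(\cdot)=|E_p(\cdot)|$. 3. Return the set of deleted vertices. Cost model: EREW-PRAM. Using standard parallel techniques, each iteration of the while loop beginning with $q$ remaining edges is done in $O(\ln q)$ time and $O(r\,q)$ operations. ''Operations'' means total work; the number of processors is the work divided by the time (Work-Time Scheduling Principle).
   Formalization: Edges are taken nonempty, m ≥ 2, and 0 < ε ≤ ε0 for an arbitrary fixed ε0 < 1 on which the O-constant may depend: for m = 1, ε ≥ 1 or ε → 1 the stated bounds vanish or turn negative (or M/ln² m is undefined) though an iteration is made. *)

(* Defs.v *)
From HB Require Import structures.
From mathcomp Require Import all_boot all_order all_algebra.
From mathcomp Require Import all_classical all_reals all_analysis.

Set Implicit Arguments.
Unset Strict Implicit.
Unset Printing Implicit Defensive.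

Import Order.TTheory GRing.Theory Num.Theory.
Local Open Scope ring_scope.

(* A hypergraph on the vertex type T is given by its edge set E : {set {set T}}. *)

Definition rank (T : finType) (E : {set {set T}}) : nat :=
  (\max_(e in E) #|e|)%N.

Definition hsize (T : finType) (E : {set {set T}}) : nat :=
  (\sum_(e in E) #|e|)%N.

(* State of algorithm Cover between two iterations.  The sets E_p(v) and the
   degrees d_p(v) are read off from the set of remaining edges. *)
Record state (R : realType) (T : finType) := State {
  residual : T -> R;            (* w_p *)
  remaining : {set {set T}};
  deleted : {set T}
}.

Definition Ep (R : realType) (T : finType) (s : state R T) (v : T) :
    {set {set T}} :=
  [set e in remaining s | v \in e].

Definition dp (R : realType) (T : finType) (s : state R T) (v : T) : nat :=
  #|Ep s v|.

Definition ratio (R : realType) (T : finType) (s : state R T) (v : T) : R :=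
  residual s v / (dp s v)%:R.

(* min_(v in e) w_p(v) / d_p(v); the vertex v0 only witnesses that e is not
   empty, and the value on the empty edge is a dummy. *)
Definition delta (R : realType) (T : finType) (s : state R T) (e : {set T}) : R :=
  if [pick v in e] is Some v0
  then ratio s [arg min_(v < v0 in e) ratio s v]%O
  else 0.

Definition init (R : realType) (T : finType) (E : {set {set T}}) (w : T -> R) :
    state R T :=
  State w E finset.set0.

Definition updated_weight (R : realType) (T : finType) (s : state R T) (v : T) : R :=
  if v \in deleted s then residual s v
  else residual s v - \sum_(e in Ep s v) delta s e.

Definition newly_deleted (R : realType) (T : finType) (w : T -> R) (eps : R)
    (s : state R T) : {set T} :=
  [set v | (v \notin deleted s) && (updated_weight s v <= eps * w v)].

Definition iteration (R : realType) (T : finType) (w : T -> R) (eps : R)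
    (s : state R T) : state R T :=
  State (updated_weight s)
        [set e in remaining s | [disjoint e & newly_deleted w eps s]]
        (deleted s :|: newly_deleted w eps s).

Definition cover_state (R : realType) (T : finType) (E : {set {set T}})
    (w : T -> R) (eps : R) (k : nat) : state R T :=
  iter k (iteration w eps) (init E w).

(* The while loop exits after exactly N iterations. *)
Definition halts_after (R : realType) (T : finType) (E : {set {set T}})
    (w : T -> R) (eps : R) (N : nat) : Prop :=
  remaining (cover_state E w eps N) = finset.set0 /\
  forall k, (k < N)%N -> remaining (cover_state E w eps k) != finset.set0.

(* Work-time description of a PRAM computation: the list of the numbers of
   operations performed in its successive parallel time steps. *)
Definition trace := seq nat.

Definition par_time (tr : trace) : nat := size tr.

Definition operations (tr : trace) : nat := sumn tr.

(* Work-Time Scheduling Principle: p processors execute a parallel step made of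
   x operations in ceil(x / p) time units. *)
Definition sched_time (p : nat) (tr : trace) : nat :=
  (\sum_(x <- tr) ((x + p.-1) %/ p))%N.

(* EREW-PRAM cost of Cover, with c the implied constant: an iteration beginning
   with q remaining edges takes O(ln q) time and O(r q) operations.  The
   summand 1 in the time bounds matters when q = 1, where ln q = 0. *)
Definition iteration_cost (R : realType) (c : R) (r q : nat) (tr : trace) : Prop :=
  (par_time tr)%:R <= c * (1 + ln q%:R) /\
  (operations tr)%:R <= c * (r * q)%:R.

(* Initialisation and output, linear in the size M of the hypergraph. *)
Definition outside_cost (R : realType) (c : R) (M : nat) (tr : trace) : Prop :=
  (par_time tr)%:R <= c * (1 + ln M%:R) /\
  (operations tr)%:R <= c * M%:R.

Definition run_trace (outside : trace) (body : nat -> trace) (N : nat) : trace :=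
  outside ++ flatten [seq body k | k <- iota 0 N].

(* The executions of Cover on (E, w, eps), when it halts after N iterations,
   under the above cost model. *)
Definition cover_trace (R : realType) (c : R) (T : finType) (E : {set {set T}})
    (w : T -> R) (eps : R) (N : nat) (tr : trace) : Prop :=
  exists (outside : trace) (body : nat -> trace),
    [/\ outside_cost c (hsize E) outside,
        forall k, (k < N)%N ->
          iteration_cost c (rank E) #|remaining (cover_state E w eps k)| (body k)
      & tr = run_trace outside body N].

(* Main.v *)
(* The potential Phi = sum over undeleted v of d_p(v) ln(w_p(v) / (eps w(v)))
   drops in each iteration by at least the number of edges that survive it, and
   with L = ln(1/eps) it is at most L times the total size of the remaining
   edges.  Hence, if q_k edges remain before iteration k, then
   sum_(j >= k) q_j <= (r L + 1) q_k and sum_j q_j <= M L + m.  The first bound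
   makes q halve every O(r L) iterations, so there are O(r L ln m) of them; the
   second bounds the operations.  Since ln^2 m <= m <= M there is at least one
   processor, so rounding p down costs at most a factor 2. *)
Require Import Defs.
From HB Require Import structures.
From mathcomp Require Import all_boot all_order all_algebra.
From mathcomp Require Import all_classical all_reals all_analysis.
From mathcomp Require Import lra ring.

Set Implicit Arguments.
Unset Strict Implicit.
Unset Printing Implicit Defensive.

Import Order.TTheory GRing.Theory Num.Theory.
Local Open Scope ring_scope.

(** * Logarithm estimates and comparison of sums *)

Lemma ln_le_subr1 (R : realType) (x : R) : 0 < x -> ln x <= x - 1.
Proof.
move=> x_gt0; have := @le_ln1Dx R (x - 1).
by rewrite (addrC 1) subrK; apply; lra.
Qed.

(** The tangent bound [ln z <= z - 1] at [z = y / x]. It turns a relative decrease of a residual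
    weight into a drop of its logarithm. *)
Lemma ln_drop_ge (R : realType) (x y : R) :
  0 < x -> 0 < y -> (x - y) / x <= ln x - ln y.
Proof.
move=> x_gt0 y_gt0; have := ln_le_subr1 (divr_gt0 y_gt0 x_gt0).
rewrite ln_div ?posrE // mulrBl divff ?gt_eqF //; lra.
Qed.

(** With [x = t ^+ 4], [ln x = 4 ln t <= 4 (t - 1) <= t ^+ 2], the last step being
    [(t - 2) ^+ 2 >= 0]; squaring gives the claim. *)
Lemma ln_sqr_le (R : realType) (x : R) : 1 <= x -> ln x ^+ 2 <= x.
Proof.
move=> x_ge1; set t := Num.sqrt (Num.sqrt x).
have x_gt0 : 0 < x by lra.
have t_gt0 : 0 < t by rewrite !sqrtr_gt0.
have t4 : x = t ^+ 4 by rewrite (exprM t 2 2) !sqr_sqrtr // ltW // sqrtr_gt0.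
have ln_le : ln x <= t ^+ 2.
  rewrite t4 lnXn // -mulr_natl; have := ln_le_subr1 t_gt0.
  have := sqr_ge0 (t - 2); nra.
rewrite {2}t4 (exprM t 2 2); have ln0 := ln_ge0 x_ge1.
by rewrite ler_pXn2r ?nnegrE // sqr_ge0.
Qed.

(** The bound [ln n >= 1 - 1/n]. It later lets additive constants be absorbed into multiples of
    [ln m]. *)
Lemma ln_nat_ge_half (R : realType) (n : nat) : (1 < n)%N -> 2^-1 <= ln (n%:R : R).
Proof.
move=> n_gt1; have n2 : (2 : R) <= n%:R by rewrite ler_nat.
have n_gt0 : (0 : R) < n%:R by lra.
have := ln_drop_ge n_gt0 (@ltr01 R); rewrite ln1 subr0; apply: le_trans.
rewrite ler_pdivlMr //; lra.
Qed.

Lemma trunc_log2_le_ln (R : realType) (n : nat) : (0 < n)%N ->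
  (trunc_log 2 n)%:R <= 2 * ln (n%:R : R).
Proof.
move=> n_gt0; have ln2 := @ln_nat_ge_half R 2 isT.
have : ln ((2 ^ trunc_log 2 n)%:R : R) <= ln n%:R.
  by rewrite ler_ln ?posrE ?ltr0n ?expn_gt0 // ler_nat trunc_logP.
rewrite natrX lnXn // -[_ *+ trunc_log _ _]mulr_natl.
have := ler_wpM2l (ler0n R (trunc_log 2 n)) ln2. lra.
Qed.

Lemma ler_sum_subset (R : numDomainType) (I : finType) (P Q : pred I) (F : I -> R) :
  (forall i, P i -> Q i) -> (forall i, Q i -> 0 <= F i) ->
  \sum_(i | P i) F i <= \sum_(i | Q i) F i.
Proof.
move=> PQ F_ge0; rewrite big_mkcond [leRHS]big_mkcond; apply: ler_sum => i _.
by case: ifPn => [/PQ-> //|_]; case: ifP => // /F_ge0.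
Qed.

(** * Integer sequences that halve at a fixed pace *)

(** Since [q 0 < 2 ^ (trunc_log 2 (q 0)).+1], that many halvings leave a natural number below 1. *)
Lemma halving_eq0 (q : nat -> nat) (J : nat) :
  (forall k, 2 * q (k + J) <= q k)%N -> q (J * (trunc_log 2 (q 0)).+1)%N = 0%N.
Proof.
move=> halve.
have pow_le i : (2 ^ i * q (J * i) <= q 0)%N.
  elim: i => [|i IHi]; first by rewrite muln0 mul1n.
  apply: leq_trans IHi; rewrite expnSr -mulnA leq_mul2l mulnS addnC.
  by rewrite halve orbT.
apply/eqP; rewrite -leqn0 -ltnS; have := pow_le (trunc_log 2 (q 0)).+1.
move=> /leq_ltn_trans/(_ (trunc_log_ltn (q 0) (isT : 1 < 2)%N)).
by rewrite -{2}[(2 ^ _)%N]muln1 ltn_mul2l => /andP[].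
Qed.

(* The terms of [q] from [k] to [k + J] are all at least [q (k + J)], so a bound
   [B * q k] on their sum forces [q] to halve within [J >= 2 B] steps. *)
Lemma tail_sum_halving (R : realType) (q : nat -> nat) (B : R) (J : nat) :
  (forall k, q k.+1 <= q k)%N ->
  (forall k n, \sum_(k <= j < n) (q j)%:R <= B * (q k)%:R) ->
  0 < B -> 2 * B <= J%:R -> forall k, (2 * q (k + J) <= q k)%N.
Proof.
move=> q_noninc tail_le B_gt0 J_ge k.
have q_anti i j : (i <= j)%N -> (q j <= q i)%N.
  move=> le_ij; rewrite -(subnK le_ij); elim: (j - i)%N => // d IHd.
  by rewrite addSn; apply: leq_trans (q_noninc _) IHd.
have lower : J%:R * (q (k + J))%:R <= \sum_(k <= j < k + J) (q j)%:R :> R.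
  have <- : \sum_(k <= j < k + J) (q (k + J))%:R = J%:R * (q (k + J))%:R :> R.
    by rewrite sumr_const_nat addKn mulr_natl.
  by apply: ler_sum_nat => j /andP[_ /ltnW lt_j]; rewrite ler_nat q_anti.
have {lower} := le_trans lower (tail_le k (k + J)%N).
rewrite -(@ler_nat R) natrM => upper; rewrite -(ler_pM2l B_gt0).
by apply: le_trans upper; rewrite mulrA ler_wpM2r // mulrC.
Qed.

(** * Loop invariant and potential drop *)

(** The loop invariant. Its first clause keeps [delta] off its dummy value; the strict lower bound
    in the third keeps the logarithms in [potential] nonnegative. *)
Definition feasible (R : realType) (T : finType) (w : T -> R) (eps : R)
    (s : state R T) : Prop :=
  [/\ finset.set0 \notin remaining s,
      forall e v, e \in remaining s -> v \in e -> v \notin deleted s &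
      forall v, v \notin deleted s -> eps * w v < residual s v <= w v].

Definition potential (R : realType) (T : finType) (w : T -> R) (eps : R)
    (s : state R T) : R :=
  \sum_(v | v \notin deleted s) (dp s v)%:R * ln (residual s v / (eps * w v)).

(** Double counting of the incidences between vertices and remaining edges. *)
Lemma sum_dp (R : realType) (T : finType) (s : state R T) :
  (\sum_v dp s v)%N = (\sum_(e in remaining s) #|e|)%N.
Proof.
rewrite (eq_bigr (fun v => \sum_(e in remaining s | v \in e) 1)%N); last first.
  by move=> v _; rewrite sum1dep_card.
rewrite (exchange_big_dep (mem (remaining s))) /=; last by move=> v e _ /andP[].
apply: eq_bigr => e es; rewrite -sum1_card.
by apply: eq_bigl => v; rewrite es.
Qed.

Lemma delta_argmin (R : realType) (T : finType) (s : state R T) (e : {set T}) :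
  e != finset.set0 -> exists2 v, v \in e & delta s e = Defs.ratio s v.
Proof.
case/finset.set0Pn=> v0 v0e; rewrite /delta; case: pickP => [v1 v1e|]; last first.
  by move/(_ v0); rewrite v0e.
by case: arg_minP => // v ve _; exists v.
Qed.

Lemma delta_ge0 (R : realType) (T : finType) (w : T -> R) (eps : R)
    (s : state R T) (e : {set T}) :
  (forall v, 0 < w v) -> 0 < eps -> feasible w eps s -> e \in remaining s ->
  0 <= delta s e.
Proof.
move=> w_gt0 eps_gt0 [no0 alive bnd] es.
have [v ve ->] : exists2 v, v \in e & delta s e = Defs.ratio s v.
  by apply: delta_argmin; apply: contraNneq no0 => <-.
have /andP[lo _] := bnd v (alive e v es ve).
by rewrite divr_ge0 // ltW // (lt_trans _ lo) // mulr_gt0.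
Qed.

Lemma feasible_init (R : realType) (T : finType) (E : {set {set T}})
    (w : T -> R) (eps : R) :
  (forall v, 0 < w v) -> eps < 1 -> finset.set0 \notin E ->
  feasible w eps (init E w).
Proof.
move=> w_gt0 eps_lt1 no0; split=> //= [e v _ _|v _]; first by rewrite inE.
by rewrite lexx andbT gtr_pMl.
Qed.

Lemma residual_iteration (R : realType) (T : finType) (w : T -> R) (eps : R)
    (s : state R T) (v : T) :
  v \notin deleted (iteration w eps s) ->
  [/\ v \notin deleted s, eps * w v < residual (iteration w eps s) v &
   residual (iteration w eps s) v = residual s v - \sum_(e in Ep s v) delta s e].
Proof.
rewrite /= finset.in_setU negb_or finset.in_set => /andP[vs]; rewrite vs /= -ltNge => lo.
by split=> //; rewrite /updated_weight (negbTE vs).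
Qed.

Lemma feasible_iteration (R : realType) (T : finType) (w : T -> R) (eps : R)
    (s : state R T) :
  (forall v, 0 < w v) -> 0 < eps -> feasible w eps s ->
  feasible w eps (iteration w eps s).
Proof.
move=> w_gt0 eps_gt0 feas; have [no0 alive bnd] := feas; split.
- by rewrite inE (negbTE no0).
- move=> e v /=; rewrite finset.in_setU negb_or inE => /andP[es dis] ve.
  by rewrite (alive e) // (disjointFr dis ve).
- move=> v /residual_iteration[vs -> ->] /=.
  have /andP[_ hi] := bnd v vs; apply: le_trans hi; rewrite gerBl.
  apply: sumr_ge0 => e; rewrite inE => /andP[es _].
  exact: (delta_ge0 w_gt0 eps_gt0 feas).
Qed.

Lemma feasible_cover_state (R : realType) (T : finType) (E : {set {set T}})
    (w : T -> R) (eps : R) (k : nat) :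
  (forall v, 0 < w v) -> 0 < eps -> eps < 1 -> finset.set0 \notin E ->
  feasible w eps (cover_state E w eps k).
Proof.
move=> w_gt0 eps_gt0 eps_lt1 no0; elim: k => [|k IHk].
  exact: feasible_init.
by rewrite /cover_state iterS; apply: feasible_iteration.
Qed.

Lemma remaining_iteration (R : realType) (T : finType) (w : T -> R) (eps : R)
    (s : state R T) : remaining (iteration w eps s) \subset remaining s.
Proof. by apply/fintype.subsetP => e /=; rewrite inE => /andP[]. Qed.

Lemma remaining_cover_state (R : realType) (T : finType) (E : {set {set T}})
    (w : T -> R) (eps : R) (k : nat) :
  remaining (cover_state E w eps k) \subset E.
Proof.
elim: k => [|k IHk] //; rewrite /cover_state iterS.
exact: fintype.subset_trans (remaining_iteration w eps _) IHk.
Qed.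

(** The invariant places the argument of the logarithm between 1 and [1 / eps]. *)
Lemma ln_ratio_itv (R : realType) (T : finType) (w : T -> R) (eps : R)
    (s : state R T) (v : T) :
  (forall v, 0 < w v) -> 0 < eps -> feasible w eps s -> v \notin deleted s ->
  0 <= ln (residual s v / (eps * w v)) <= ln (1 / eps).
Proof.
move=> w_gt0 eps_gt0 [_ _ bnd] vs; have /andP[lo hi] := bnd v vs.
have ew_gt0 : 0 < eps * w v by rewrite mulr_gt0.
apply/andP; split.
  by apply: ln_ge0; rewrite ler_pdivlMr // mul1r ltW.
have res_gt0 := lt_trans ew_gt0 lo.
rewrite ler_ln ?posrE ?divr_gt0 //.
by rewrite ler_pdivrMr // mulrA div1r mulVf ?gt_eqF // mul1r.
Qed.

Lemma potential_ge0 (R : realType) (T : finType) (w : T -> R) (eps : R)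
    (s : state R T) :
  (forall v, 0 < w v) -> 0 < eps -> feasible w eps s -> 0 <= potential w eps s.
Proof.
move=> w_gt0 eps_gt0 feas; apply: sumr_ge0 => v vs; rewrite mulr_ge0 //.
by case/andP: (ln_ratio_itv w_gt0 eps_gt0 feas vs).
Qed.

Lemma potential_le (R : realType) (T : finType) (w : T -> R) (eps : R)
    (s : state R T) :
  (forall v, 0 < w v) -> 0 < eps -> eps < 1 -> feasible w eps s ->
  potential w eps s <= (\sum_(e in remaining s) #|e|)%:R * ln (1 / eps).
Proof.
move=> w_gt0 eps_gt0 eps_lt1 feas; rewrite -sum_dp natr_sum mulr_suml.
rewrite [leRHS](bigID (fun v => v \notin deleted s)) /= -[leLHS]addr0 lerD //.
  apply: ler_sum => v vs; rewrite ler_wpM2l //.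
  by case/andP: (ln_ratio_itv w_gt0 eps_gt0 feas vs).
apply: sumr_ge0 => v _; rewrite mulr_ge0 // ln_ge0 //.
by rewrite ler_pdivlMr // mul1r ltW.
Qed.

(* An edge [e] surviving the iteration has a vertex [v] with [delta e = ratio v];
   [v] survives too, and the share of [e] in its decrease is
   [d_p(v) * (delta e / w_p(v)) = 1].  Edges that are removed need not pay. *)
Lemma potential_iteration (R : realType) (T : finType) (w : T -> R) (eps : R)
    (s : state R T) :
  (forall v, 0 < w v) -> 0 < eps -> feasible w eps s ->
  potential w eps (iteration w eps s) + #|remaining (iteration w eps s)|%:R
    <= potential w eps s.
Proof.
move=> w_gt0 eps_gt0 feas; set s' := iteration w eps s.
have feas' : feasible w eps s' by apply: feasible_iteration.
have [no0 alive bnd] := feas; have [no0' alive' bnd'] := feas'.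
have res_gt0 v : v \notin deleted s -> 0 < residual s v.
  by move=> vs; have /andP[/(lt_trans _)-> //] := bnd v vs; rewrite mulr_gt0.
have res'_gt0 v : v \notin deleted s' -> 0 < residual s' v.
  by move=> vs; have /andP[/(lt_trans _)-> //] := bnd' v vs; rewrite mulr_gt0.
have alive_sub v : v \notin deleted s' -> v \notin deleted s.
  by case/residual_iteration.
have dp_mono v : (dp s' v <= dp s v)%N.
  apply: subset_leq_card; apply/fintype.subsetP => e; rewrite !inE.
  by case/andP => /andP[-> _ ->].
(* Each incident edge [e] contributes [delta s e / ratio s v], so [share v] is [dp s v] times the
   relative decrease of [residual s v] when [v] survives. *)
pose share v := \sum_(e in Ep s v) delta s e / Defs.ratio s v.
have vertex_drop v : v \notin deleted s' ->
    (dp s' v)%:R * ln (residual s' v / (eps * w v)) + share v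
    <= (dp s v)%:R * ln (residual s v / (eps * w v)).
  move=> vs'; have vs := alive_sub v vs'.
  have ew := mulr_gt0 eps_gt0 (w_gt0 v).
  have r0 := res_gt0 v vs; have r0' := res'_gt0 v vs'.
  have /andP[ln'_ge0 _] := ln_ratio_itv w_gt0 eps_gt0 feas' vs'.
  have -> : share v = (dp s v)%:R * ((residual s v - residual s' v) / residual s v).
    have [_ _ ->] := residual_iteration vs'.
    by rewrite subKr /share -mulr_suml /ratio invf_div; ring.
  (* The degree and the logarithm both shrink. The degree is first raised back to [dp s v], which is
     allowed because the new logarithm is nonnegative; then [ln_drop_ge] applies. *)
  apply: (@le_trans _ _ ((dp s v)%:R * ln (residual s' v / (eps * w v)) +
     (dp s v)%:R * ((residual s v - residual s' v) / residual s v))).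
    by rewrite lerD2r ler_wpM2r // ler_nat.
  rewrite -mulrDr ler_wpM2l // !ln_div ?posrE //.
  by have := ln_drop_ge r0 r0'; lra.
have share_ge0 v e : v \notin deleted s -> e \in remaining s ->
    0 <= delta s e / Defs.ratio s v.
  move=> vs es; rewrite !divr_ge0 ?(ltW (res_gt0 v vs)) //.
  exact: (delta_ge0 w_gt0 eps_gt0 feas).
have edges_le : #|remaining s'|%:R <= \sum_(v | v \notin deleted s') share v :> R.
  rewrite -sum1_card natr_sum.
  apply: (@le_trans _ _ (\sum_(e in remaining s')
      \sum_(v | (v \notin deleted s') && (v \in e)) delta s e / Defs.ratio s v)).
    apply: ler_sum => e es'.
    have es := fintype.subsetP (remaining_iteration w eps s) e es'.
    have [v ve dE] : exists2 v, v \in e & delta s e = Defs.ratio s v.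
      by apply: delta_argmin; apply: contraNneq no0 => <-.
    have vs' := alive' e v es' ve.
    (* The minimizing vertex alone contributes exactly 1. Its ratio is nonzero because [e] itself
       makes its degree positive. *)
    rewrite (bigD1 v) ?vs' //= dE divff; last first.
      rewrite mulf_neq0 ?invr_eq0 ?gt_eqF ?res_gt0 ?alive_sub //.
      by rewrite ltr0n card_gt0; apply/finset.set0Pn; exists e; rewrite inE es.
    rewrite lerDl; apply: sumr_ge0 => u /andP[/andP[us' ue] _].
    by rewrite -dE share_ge0 // alive_sub.
  rewrite (exchange_big_dep (fun v => v \notin deleted s')) /=; last first.
    by move=> e v _ /andP[].
  (* After the exchange of sums, [v] is charged only by surviving edges, which form a subset of
     [Ep s v]. *)
  apply: ler_sum => v vs'; apply: ler_sum_subset => e; rewrite !inE.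
    by move=> /andP[/andP[-> _]] /andP[_ ->].
  by case/andP => es _; apply: share_ge0 => //; apply: alive_sub.
have /le_trans -> // : potential w eps s' + #|remaining s'|%:R <=
    \sum_(v | v \notin deleted s') (dp s v)%:R * ln (residual s v / (eps * w v)).
  apply: le_trans (lerD (lexx _) edges_le) _.
  by rewrite -big_split; apply: ler_sum => v vs'; apply: vertex_drop.
(* Vertices deleted in this iteration have nonnegative terms in the old potential, so adding them
   back only helps. *)
apply: ler_sum_subset => v; first exact: alive_sub.
move=> vs; rewrite mulr_ge0 //.
by case/andP: (ln_ratio_itv w_gt0 eps_gt0 feas vs).
Qed.

(** * Total edge counts and the number of iterations *)

Lemma rank_ge (T : finType) (E : {set {set T}}) (e : {set T}) :
  e \in E -> (#|e| <= rank E)%N.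
Proof. by move=> eE; rewrite /rank (bigop.bigmax_sup e). Qed.

Lemma rank_gt0 (T : finType) (E : {set {set T}}) :
  finset.set0 \notin E -> (0 < #|E|)%N -> (0 < rank E)%N.
Proof.
move=> no0; rewrite card_gt0 => /finset.set0Pn[e eE].
apply: leq_trans (rank_ge eE); rewrite card_gt0.
by apply: contraNneq no0 => <-.
Qed.

Lemma card_le_hsize (T : finType) (E : {set {set T}}) :
  finset.set0 \notin E -> (#|E| <= hsize E)%N.
Proof.
move=> no0; rewrite -sum1_card; apply: leq_sum => e eE; rewrite card_gt0.
by apply: contraNneq no0 => <-.
Qed.

Lemma hsize_subset_le (T : finType) (E F : {set {set T}}) :
  F \subset E -> (hsize F <= rank E * #|F|)%N.
Proof.
move=> FE; rewrite mulnC -sum_nat_const; apply: leq_sum => e eF.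
exact/rank_ge/(fintype.subsetP FE).
Qed.

Lemma cover_stateS (R : realType) (T : finType) (E : {set {set T}})
    (w : T -> R) (eps : R) (k : nat) :
  cover_state E w eps k.+1 = iteration w eps (cover_state E w eps k).
Proof. exact: iterS. Qed.

(** The potential drops telescope. Iteration [j] pays for the edges present at [j + 1], so the edges
    present at [k] remain as an extra term. *)
Lemma sum_remaining_le (R : realType) (T : finType) (E : {set {set T}})
    (w : T -> R) (eps : R) (k n : nat) :
  (forall v, 0 < w v) -> 0 < eps -> eps < 1 -> finset.set0 \notin E ->
  \sum_(k <= j < n) #|remaining (cover_state E w eps j)|%:R
    <= potential w eps (cover_state E w eps k)
       + #|remaining (cover_state E w eps k)|%:R.
Proof.
move=> w_gt0 eps_gt0 eps_lt1 no0.
have feas j : feasible w eps (cover_state E w eps j).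
  exact: feasible_cover_state.
have pot_ge0 j : 0 <= potential w eps (cover_state E w eps j).
  exact: potential_ge0.
have [lt_nk|le_kn] := ltnP n k; first by rewrite big_geq ?addr_ge0 // ltnW.
(* Keeping the final potential and edge count on the left makes the induction on [n - k] close. *)
suff : potential w eps (cover_state E w eps n)
    + #|remaining (cover_state E w eps n)|%:R
    + \sum_(k <= j < n) #|remaining (cover_state E w eps j)|%:R
    <= potential w eps (cover_state E w eps k)
       + #|remaining (cover_state E w eps k)|%:R.
  by apply: le_trans; rewrite lerDr addr_ge0.
rewrite -(subnK le_kn) addnC; elim: (n - k)%N => [|d IHd].
  by rewrite addn0 big_geq // addr0.
rewrite addnS big_nat_recr ?leq_addr //=; apply: le_trans IHd.
have := potential_iteration w_gt0 eps_gt0 (feas (k + d)%N).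
by rewrite -cover_stateS; lra.
Qed.

Lemma sum_remaining_le_tail (R : realType) (T : finType) (E : {set {set T}})
    (w : T -> R) (eps : R) (k n : nat) :
  (forall v, 0 < w v) -> 0 < eps -> eps < 1 -> finset.set0 \notin E ->
  \sum_(k <= j < n) #|remaining (cover_state E w eps j)|%:R
    <= ((rank E)%:R * ln (1 / eps) + 1)
       * #|remaining (cover_state E w eps k)|%:R.
Proof.
move=> w_gt0 eps_gt0 eps_lt1 no0.
apply: le_trans (sum_remaining_le k n w_gt0 eps_gt0 eps_lt1 no0) _.
rewrite mulrDl [1 * _%:R]mul1r lerD2r.
apply: le_trans (potential_le w_gt0 eps_gt0 eps_lt1 _) _.
  exact: feasible_cover_state.
have L_ge0 : 0 <= ln (1 / eps) by rewrite ln_ge0 // ler_pdivlMr // mul1r ltW.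
rewrite mulrAC ler_wpM2r // -natrM ler_nat.
exact/hsize_subset_le/remaining_cover_state.
Qed.

Lemma sum_remaining_le_hsize (R : realType) (T : finType) (E : {set {set T}})
    (w : T -> R) (eps : R) (n : nat) :
  (forall v, 0 < w v) -> 0 < eps -> eps < 1 -> finset.set0 \notin E ->
  \sum_(0 <= j < n) #|remaining (cover_state E w eps j)|%:R
    <= (hsize E)%:R * (ln (1 / eps) + 1).
Proof.
move=> w_gt0 eps_gt0 eps_lt1 no0.
apply: le_trans (sum_remaining_le 0 n w_gt0 eps_gt0 eps_lt1 no0) _.
rewrite mulrDr mulr1 lerD ?ler_nat ?card_le_hsize //.
by apply: potential_le => //; apply: feasible_init.
Qed.

(** The first factor bounds the number [J] of iterations per halving, the second the number of
    halvings that empty the edge set. *)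
Lemma halts_after_bound (R : realType) (T : finType) (E : {set {set T}})
    (w : T -> R) (eps : R) :
  (forall v, 0 < w v) -> 0 < eps -> eps < 1 -> finset.set0 \notin E ->
  (0 < #|E|)%N ->
  exists2 N, halts_after E w eps N &
    N%:R <= (2 * ((rank E)%:R * ln (1 / eps) + 1) + 1) * (2 * ln #|E|%:R + 1).
Proof.
move=> w_gt0 eps_gt0 eps_lt1 no0 m_gt0.
pose q k := #|remaining (cover_state E w eps k)|.
have L_ge0 : 0 <= ln (1 / eps) by rewrite ln_ge0 // ler_pdivlMr // mul1r ltW.
set B := (rank E)%:R * ln (1 / eps) + 1.
have B_gt0 : 0 < B by rewrite ltr_wpDl // mulr_ge0.
(* The successor ensures [2 * B <= J], at the cost of [J <= 2 * B + 1]. *)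
pose J := (Num.truncn (2 * B)).+1.
have /andP[J_lo J_hi] : (Num.truncn (2 * B))%:R <= 2 * B < J%:R.
  by apply: truncn_itv; lra.
have q_halve : forall k, (2 * q (k + J) <= q k)%N.
  apply: (@tail_sum_halving R q B) => [k|k n||] //; last exact: ltW.
    by rewrite /q cover_stateS subset_leq_card // remaining_iteration.
  exact: sum_remaining_le_tail.
have empty_ex : exists k, remaining (cover_state E w eps k) == finset.set0.
  exists (J * (trunc_log 2 (q 0)).+1)%N; rewrite -cards_eq0.
  by rewrite -/(q _) halving_eq0.
(* Minimality of [N] gives the second half of [halts_after]: no earlier state is empty. *)
case: (ex_minnP empty_ex) => N /eqP N_empty N_min; exists N.
  split=> // k; rewrite ltnNge; apply: contra => /eqP k_empty.
  by apply: N_min; rewrite k_empty.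
have : (N <= J * (trunc_log 2 #|E|).+1)%N.
  by apply: N_min; rewrite -cards_eq0 -/(q _) (halving_eq0 q_halve).
rewrite -(ler_nat R) natrM => /le_trans-> //; apply: ler_pM => //.
  by rewrite /J -natr1 lerD2r.
by rewrite -natr1 lerD2r trunc_log2_le_ln.
Qed.

(** * Parallel time, operations and scheduling *)

Lemma par_time_run_trace (o : trace) (body : nat -> trace) (N : nat) :
  par_time (run_trace o body N)
  = (par_time o + \sum_(0 <= k < N) par_time (body k))%N.
Proof.
rewrite /par_time /run_trace size_cat size_flatten /index_iota subn0.
by congr addn; elim: (iota 0 N) => [|k l IHl]; rewrite ?big_nil // big_cons -IHl.
Qed.

Lemma operations_run_trace (o : trace) (body : nat -> trace) (N : nat) :
  operations (run_trace o body N)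
  = (operations o + \sum_(0 <= k < N) operations (body k))%N.
Proof.
rewrite /operations /run_trace sumn_cat sumn_flatten /index_iota subn0.
by congr addn; elim: (iota 0 N) => [|k l IHl]; rewrite ?big_nil // big_cons -IHl.
Qed.

(** Each parallel step costs at most [x / p + 1], by rounding up. *)
Lemma sched_time_le (R : realType) (p : nat) (tr : trace) : (0 < p)%N ->
  (sched_time p tr)%:R <= (operations tr)%:R / p%:R + (par_time tr)%:R :> R.
Proof.
move=> p_gt0; have pR : (0 : R) < p%:R by rewrite ltr0n.
rewrite /operations sumnE /par_time -sum1_size /sched_time !natr_sum mulr_suml.
rewrite -big_split; apply: ler_sum => x _ /=.
rewrite -(ler_pM2r pR) mulrDl divfK ?gt_eqF // mul1r -natrD -natrM ler_nat.
by rewrite (leq_trans (leq_trunc_div _ _)) // leq_add2l leq_pred.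
Qed.

(** The summand [rank E] helps to pay for [ln M] outside the loop; [|c|] replaces [c], whose sign is
    unrestricted. *)
Lemma par_time_cover_le (R : realType) (c : R) (T : finType) (E : {set {set T}})
    (w : T -> R) (eps : R) (N : nat) (tr : trace) :
  finset.set0 \notin E -> (0 < #|E|)%N -> halts_after E w eps N ->
  cover_trace c E w eps N tr ->
  (par_time tr)%:R <= `|c| * ((rank E)%:R + ln #|E|%:R + N%:R * (1 + ln #|E|%:R)).
Proof.
move=> no0 m_gt0 [_ run] [out [body [[time_out _] cost ->]]].
rewrite par_time_run_trace natrD mulrDr natr_sum.
have r_gt0 : (0 : R) < (rank E)%:R by rewrite ltr0n rank_gt0.
have mR : (0 : R) < #|E|%:R by rewrite ltr0n.
have M_ge1 : (1 : R) <= (hsize E)%:R.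
  by rewrite ler1n (leq_trans m_gt0) // card_le_hsize.
apply: lerD.
  apply: le_trans time_out _.
  have lnM_ge0 := ln_ge0 M_ge1.
  (* From [M <= r m] and [ln r <= r - 1]. *)
  have lnM : ln (hsize E)%:R <= (rank E)%:R - 1 + ln #|E|%:R :> R.
    apply: (@le_trans _ _ (ln ((rank E)%:R * #|E|%:R))).
      have M_gt0 : (0 : R) < (hsize E)%:R by exact: lt_le_trans M_ge1.
      rewrite ler_ln ?posrE ?mulr_gt0 //.
      by rewrite -natrM ler_nat hsize_subset_le.
    by rewrite lnM ?posrE // lerD2r ln_le_subr1.
  apply: (@le_trans _ _ (`|c| * (1 + ln (hsize E)%:R))).
    by rewrite ler_wpM2r ?ler_norm //; lra.
  by rewrite ler_wpM2l //; lra.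
have -> : `|c| * (N%:R * (1 + ln #|E|%:R))
    = \sum_(0 <= k < N) `|c| * (1 + ln #|E|%:R) :> R.
  by rewrite sumr_const_nat subn0 -mulr_natl; ring.
apply: ler_sum_nat => k /andP[_ kN]; have [time_le _] := cost k kN.
(* Before the exit at least one edge remains, so [ln q >= 0] and passing from [c] to [|c|] can only
   enlarge the bound. *)
have q_gt0 : (0 < #|remaining (cover_state E w eps k)|)%N.
  by rewrite card_gt0 run.
have lnq : ln #|remaining (cover_state E w eps k)|%:R <= ln #|E|%:R :> R.
  by rewrite ler_ln ?posrE ?ltr0n // ler_nat subset_leq_card // remaining_cover_state.
have lnq_ge0 : 0 <= ln #|remaining (cover_state E w eps k)|%:R :> R.
  by rewrite ln_ge0 // ler1n.
apply: le_trans time_le _.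
apply: (@le_trans _ _ (`|c| * (1 + ln #|remaining (cover_state E w eps k)|%:R))).
  by rewrite ler_wpM2r ?ler_norm //; lra.
by rewrite ler_wpM2l // lerD2l.
Qed.

Lemma operations_cover_le (R : realType) (c : R) (T : finType) (E : {set {set T}})
    (w : T -> R) (eps : R) (N : nat) (tr : trace) :
  (forall v, 0 < w v) -> 0 < eps -> eps < 1 -> finset.set0 \notin E ->
  cover_trace c E w eps N tr ->
  (operations tr)%:R
    <= `|c| * ((hsize E)%:R + (rank E)%:R * ((hsize E)%:R * (ln (1 / eps) + 1))).
Proof.
move=> w_gt0 eps_gt0 eps_lt1 no0 [out [body [[_ ops_out] cost ->]]].
rewrite operations_run_trace natrD mulrDr natr_sum; apply: lerD.
  by apply: le_trans ops_out _; rewrite ler_wpM2r // ler_norm.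
apply: (@le_trans _ _ (\sum_(0 <= k < N) `|c| *
    ((rank E)%:R * #|remaining (cover_state E w eps k)|%:R))).
  apply: ler_sum_nat => k /andP[_ kN]; have [_ /le_trans-> //] := cost k kN.
  by rewrite natrM ler_wpM2r ?mulr_ge0 // ler_norm.
rewrite -!mulr_sumr !ler_wpM2l //.
exact: sum_remaining_le_hsize.
Qed.

Theorem mainTheorem1 (R : realType) (c eps0 : R) (eps0_lt1 : eps0 < 1) :
  exists C : R,
  forall (T : finType) (E : {set {set T}}) (w : T -> R) (eps : R),
  let m := #|E| in
  let r := rank E in
  let M := hsize E in
  finset.set0 \notin E ->
  (1 < m)%N ->
  (forall v, 0 < w v) ->
  0 < eps -> eps <= eps0 ->
  exists N : nat,
    halts_after E w eps N /\
    forall tr : trace, cover_trace c E w eps N tr ->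
      let p := Num.truncn (M%:R / ln (m%:R : R) ^+ 2) in
      [/\ (par_time tr)%:R <= C * (r%:R * ln m%:R ^+ 2 * ln (1 / eps)),
          (operations tr)%:R <= C * (r%:R * M%:R * ln (1 / eps)),
          (0 < p)%N
        & (sched_time p tr)%:R <= C * (r%:R * ln m%:R ^+ 2 * ln (1 / eps))].
Proof.
(* With [L = ln (1 / eps)], [eps <= eps0] gives [L >= ln (1 / eps0)], hence [L + 1 <= K * L]. The 46
   is 42 from the parallel time plus 4 from the operations divided by [p]. *)
set K := 1 + 1 / ln (1 / eps0); exists (46 * `|c| * K).
move=> T E w eps m r M no0 m_gt1 w_gt0 eps_gt0 eps_le.
have eps_lt1 : eps < 1 := le_lt_trans eps_le eps0_lt1.
have eps0_gt0 : 0 < eps0 := lt_le_trans eps_gt0 eps_le.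
have m_gt0 : (0 < m)%N := ltnW m_gt1.
have [N halts N_le] := halts_after_bound w_gt0 eps_gt0 eps_lt1 no0 m_gt0.
exists N; split=> // tr run p.
have time_le := par_time_cover_le no0 m_gt0 halts run.
have ops_le := operations_cover_le w_gt0 eps_gt0 eps_lt1 no0 run.
have L0_gt0 : 0 < ln (1 / eps0) by rewrite ln_gt0 // ltr_pdivlMr // mul1r.
have KL_ge : ln (1 / eps) + 1 <= K * ln (1 / eps).
  have L0_le : ln (1 / eps0) <= ln (1 / eps).
    by rewrite ler_ln ?posrE ?divr_gt0 // !div1r lef_pV2 ?posrE.
  rewrite /K; move: (ln (1 / eps)) (ln (1 / eps0)) L0_gt0 L0_le => L L0 L0_gt0 L0_le.
  by rewrite mulrDl mul1r lerD2l mulrAC mul1r ler_pdivlMr // mul1r.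
have L_ge0 : 0 <= ln (1 / eps) by rewrite ln_ge0 // ler_pdivlMr // mul1r ltW.
have u_ge : 2^-1 <= ln (m%:R : R) by apply: ln_nat_ge_half.
have r_ge1 : (1 : R) <= r%:R by rewrite ler1n rank_gt0.
have M_gt0 : (0 : R) < M%:R by rewrite ltr0n (leq_trans m_gt0) // card_le_hsize.
have u2_gt0 : 0 < ln (m%:R : R) ^+ 2 by rewrite exprn_gt0 //; lra.
have u2_le : ln (m%:R : R) ^+ 2 <= M%:R.
  rewrite (@le_trans _ _ (m%:R)) ?ler_nat ?card_le_hsize //.
  by rewrite ln_sqr_le // ler1n.
have /andP[p_lo p_hi] : p%:R <= M%:R / ln (m%:R : R) ^+ 2 < p.+1%:R.
  by apply: truncn_itv; rewrite divr_ge0 // ltW.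
have p_gt0 : (0 < p)%N.
  by rewrite lt0n; apply: contraTneq p_hi => ->; rewrite -leNgt ler_pdivlMr // mul1r.
have c_ge0 := normr_ge0 c.
have sched_le := sched_time_le R tr p_gt0.
move: time_le ops_le sched_le N_le KL_ge L_ge0 u_ge r_ge1 M_gt0 c_ge0 u2_gt0.
rewrite -/m -/r -/M.
move: (ln (1 / eps)) (ln m%:R) (r%:R) (M%:R) `|c| p_hi => L u rr MM A p_hi.
move=> time_le ops_le sched_le N_le KL_ge L_ge0 u_ge r_ge1 M_gt0 A_ge0 u2_gt0.
have KL_ge1 : 1 <= K * L by lra.
have N_le' : N%:R <= 12 * (rr * u * (K * L)).
  apply: le_trans N_le _.
  (* Uses [2 rr L + 3 <= 3 rr (L + 1)], as [rr >= 1]. The other factor satisfies [2 u + 1 <= 4 u],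
     as [u >= 1/2]; hence 12. *)
  have le1 : 2 * (rr * L + 1) + 1 <= 3 * (rr * (K * L)).
    have : rr * (L + 1) <= rr * (K * L) by rewrite ler_wpM2l //; lra.
    have : 0 <= rr * L by rewrite mulr_ge0 //; lra.
    lra.
  have -> : 12 * (rr * u * (K * L)) = 3 * (rr * (K * L)) * (4 * u) by ring.
  apply: ler_pM => //; last by lra.
    have : 0 <= rr * L by rewrite mulr_ge0 //; lra.
    lra.
  by lra.
have r_ge0 : 0 <= rr by lra.
have KL_ge0 : 0 <= K * L by lra.
have u2_ge0 : 0 <= u ^+ 2 by apply: ltW.
have M_ge0 : 0 <= MM by apply: ltW.
have base_ge0 : 0 <= A * (rr * u ^+ 2 * (K * L)).
  by do 3?[exact: KL_ge0 | apply: mulr_ge0 => //].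
have time_le' : (par_time tr)%:R <= 42 * (A * (rr * u ^+ 2 * (K * L))).
  apply: le_trans time_le _; rewrite [leRHS]mulrCA ler_wpM2l //.
  have loop : N%:R * (1 + u) <= 12 * (rr * u * (K * L)) * (3 * u).
    by apply: ler_pM => //; lra.
  (* By [u >= 1/2] and [rr >= 1], [rr <= 4 rr u^2] and [u <= 2 rr u^2]. Together with 12 times 3
     from the loop this makes 42. *)
  have ru_le : rr + u <= 6 * (rr * u ^+ 2).
    have : rr * 2^-1 <= rr * u by rewrite ler_wpM2l //; lra.
    have : rr * u * 2^-1 <= rr * u * u by rewrite ler_wpM2l // mulr_ge0; lra.
    have : 1 * u <= rr * u by rewrite ler_wpM2r //; lra.
    rewrite expr2; lra.
  have : rr * u ^+ 2 * 1 <= rr * u ^+ 2 * (K * L).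
    by rewrite ler_wpM2l // mulr_ge0.
  have -> : 42 * (rr * u ^+ 2 * (K * L)) = 6 * (rr * u ^+ 2 * (K * L))
     + 12 * (rr * u * (K * L)) * (3 * u) by ring.
  lra.
have ops_le' : (operations tr)%:R <= 2 * (A * (rr * MM * (K * L))).
  apply: le_trans ops_le _; rewrite [leRHS]mulrCA ler_wpM2l //.
  have : 1 * MM <= rr * MM by rewrite ler_wpM2r //; lra.
  have rM : 0 <= rr * MM by rewrite mulr_ge0 //; lra.
  have : rr * MM * (L + 1) <= rr * MM * (K * L) by rewrite ler_wpM2l.
  have : 0 <= rr * MM * L by rewrite mulr_ge0.
  lra.
(* [MM / u^2 < p + 1 <= 2 p], the last step because [p >= 1]. *)
have p_inv : MM / p%:R <= 2 * u ^+ 2.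
  have p_ge1 : (1 : R) <= p%:R by rewrite ler1n.
  have pR : (0 : R) < p%:R by lra.
  move: p_hi; rewrite ltr_pdivrMr // -natr1 => p_hi; rewrite ler_pdivrMr //.
  have : u ^+ 2 * 1 <= u ^+ 2 * p%:R by rewrite ler_wpM2l // ltW.
  lra.
have base2_ge0 : 0 <= A * (rr * MM * (K * L)).
  by do 3?[exact: KL_ge0 | apply: mulr_ge0 => //].
split=> //.
- by apply: le_trans time_le' _; lra.
- by apply: le_trans ops_le' _; lra.
apply: le_trans sched_le _.
have : (operations tr)%:R / p%:R <= 4 * (A * (rr * u ^+ 2 * (K * L))).
  apply: (@le_trans _ _ (2 * (A * (rr * MM * (K * L))) / p%:R)).
    by rewrite ler_wpM2r // invr_ge0.
  have -> : 2 * (A * (rr * MM * (K * L))) / p%:R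
     = 2 * (A * (rr * (K * L))) * (MM / p%:R) by ring.
  have -> : 4 * (A * (rr * u ^+ 2 * (K * L)))
     = 2 * (A * (rr * (K * L))) * (2 * u ^+ 2) by ring.
  by rewrite ler_wpM2l // mulr_ge0 // mulr_ge0 // mulr_ge0.
lra.
Qed.
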